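(* Suppose $\bar V\le 0$. Consider the platform's problem when all users choose the low level of data sharing: $$\begin{aligned}\max_{I,p_0,p_1}\;& U(k,k)-B(I)F-I-p_0k-S\\ \text{s.t. }& p_0-\alpha\mathcal V\ge p_1-\mathcal V,\quad p_0-\alpha\mathcal V\ge 0,\quad I,p_0,p_1\ge 0,\end{aligned}$$ where $\mathcal V=\bar V+B(I)L$. Then optimal choices $(I^*,p_1^*,p_0^* )$ of the platform are as follows. 1. If $I_4$ and $I_5$ exist: $(I^*=I_4,\ p_1^*=0,\ p_0^*=\alpha(\bar V+B(I_4)L))$ when $L\ge\frac{-\bar V}{B(I_4)}$; $(I^*=I_2,\ p_1^*=0,\ p_0^*=0)$ when $\frac{-\bar V}{B(I_4)}\ge L\ge\frac{-\bar V}{B(I_5)}$; and $(I^*=I_5,\ p_1^*=0,\ p_0^*=(\alpha-1)(\bar V+B(I_5)L))$ when $\frac{-\bar V}{B(I_5)}\ge L$. 2. If $I_4$ exists but $I_5$ does not: $(I^*=I_4,\ p_1^*=0,\ p_0^*=\alpha(\bar V+B(I_4)L))$ when $L\ge\frac{-\bar V}{B(I_4)}$; $(I^*=I_2,\ p_1^*=0,\ p_0^*=0)$ when $\frac{-\bar V}{B(I_4)}\ge L\ge\frac{-\bar V}{B(0)}$; and $(I^*=0,\ p_1^*=0,\ p_0^*=(\alpha-1)(\bar V+B(0)L))$ when $\frac{-\bar V}{B(0)}\ge L$. 3. If neither $I_4$ nor $I_5$ exists: $(I^*=0,\ p_1^*=0,\ p_0^*=\alpha(\bar V+B(0)L))$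 when $L\ge\frac{-\bar V}{B(0)}$; and $(I^*=0,\ p_1^*=0,\ p_0^*=(\alpha-1)(\bar V+B(0)L))$ when $\frac{-\bar V}{B(0)}\ge L$.
   Context: An online platform with $k\ge 1$ homogeneous users ($k$ an integer) chooses an investment $I\ge 0$ in data protection and data dividends $p_0,p_1\ge 0$ paid to each user for the low and high level of data sharing respectively. $B:[0,\infty)\to\mathbb{R}$ is twice differentiable with $B(I)>0$, $B'(I)<0$, $B''(I)>0$ for all $I$, and $\lim_{I\to\infty}B(I)=0$ ($B(I)$ is the probability of a data breach). $F>0$ is the platform's loss and $L>0$ each user's loss from a data breach; $S\in\mathbb{R}$ is a fixed cost; $U(k,b)\in\mathbb{R}$ is the platform's revenue when $b$ of the $k$ users choose the low level (so $U(k,k)$ is a constant here); $\alpha\in(0,1)$; $\bar V=V-W\in\mathbb{R}$, where $V$ is the value of a user's data and $W$ the value of the platform's free services. A user's expected utility is $p_1-\mathcal V$ at the high level and $p_0-\alpha\mathcal V$ at the low level, with $\mathcal V=\bar V+B(I)L$; the constraints of the problem say that the low level is utility-maximizing and gives nonnegative utility. Notation: $I_4=(B')^{-1}\left(\frac{-1}{F+\alpha Lk}\right)$ is the unique $I\ge0$ with $B'(I)=\frac{-1}{F+\alpha Lk}$; $I_5=(B')^{-1}\left(\frac{-1}{F+(\alpha-1)Lk}\right)$ is the unique $I\ge0$ with $B'(I)=\frac{-1}{F+(\alpha-1)Lk}$; $I_2=B^{-1}\left(-\frac{\bar V}{L}\right)$ is the unique $I\ge0$ with $B(I)=-\bar V/L$.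 ''Exists'' means that such a point in $[0,\infty)$ exists (in particular $I_5$ does not exist if $F+(\alpha-1)Lk\le 0$). ''Optimal choices'' means that the stated triple is an optimal solution (maximizer) of the problem. *)

(* Defs.v *)
From Stdlib Require Import Reals.
From Coquelicot Require Import Coquelicot.
Open Scope R_scope.

(* Functions on [0,oo) are represented by total functions R -> R of which only
   the values on [0,oo) are ever used. *)
Definition nonneg_half_line (x : R) : Prop := 0 <= x.

(* [D_in f f' D x] is differentiability relative to the domain [D], so the
   derivatives at 0 are right derivatives. *)
Definition twice_differentiable (B B' B'' : R -> R) : Prop :=
  forall x, 0 <= x ->
    D_in B B' nonneg_half_line x /\ D_in B' B'' nonneg_half_line x.

Definition breach_probability (B B' B'' : R -> R) : Prop :=
  twice_differentiable B B' B'' /\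
  (forall x, 0 <= x -> 0 < B x /\ B' x < 0 /\ 0 < B'' x) /\
  is_lim B p_infty 0.

(* [x] is a value of the inverse at [y] of [f] restricted to [0,oo). *)
Definition is_preimage (f : R -> R) (y x : R) : Prop := 0 <= x /\ f x = y.

(* The guard excludes the degenerate quotient -1/0, which is undefined on paper
   but has a value in [R]. *)
Definition is_marginal_point (B' : R -> R) (c x : R) : Prop :=
  c <> 0 /\ is_preimage B' (-1 / c) x.

Definition is_I4 (B' : R -> R) (k : nat) (F L alpha : R) : R -> Prop :=
  is_marginal_point B' (F + alpha * L * INR k).

Definition is_I5 (B' : R -> R) (k : nat) (F L alpha : R) : R -> Prop :=
  is_marginal_point B' (F + (alpha - 1) * L * INR k).

Definition is_I2 (B : R -> R) (L Vbar : R) : R -> Prop :=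
  is_preimage B (- Vbar / L).

(* [Vbar] is the value of a user's data minus the value of the platform's free
   services; [B I * L] is the expected loss from a breach. *)
Definition user_cost (B : R -> R) (L Vbar I : R) : R := Vbar + B I * L.

Definition utility_high (B : R -> R) (L Vbar I p1 : R) : R :=
  p1 - user_cost B L Vbar I.

Definition utility_low (B : R -> R) (L alpha Vbar I p0 : R) : R :=
  p0 - alpha * user_cost B L Vbar I.

(* [U k b] is the revenue when [b] of the [k] users choose the low level. *)
Definition platform_payoff (U : nat -> nat -> R) (B : R -> R) (k : nat)
    (F Sfix I p0 : R) : R :=
  U k k - B I * F - I - p0 * INR k - Sfix.

Definition feasible (B : R -> R) (L alpha Vbar I p1 p0 : R) : Prop :=
  utility_low B L alpha Vbar I p0 >= utility_high B L Vbar I p1 /\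
  utility_low B L alpha Vbar I p0 >= 0 /\
  I >= 0 /\ p0 >= 0 /\ p1 >= 0.

Definition optimal (U : nat -> nat -> R) (B : R -> R) (k : nat)
    (F L Sfix alpha Vbar I p1 p0 : R) : Prop :=
  feasible B L alpha Vbar I p1 p0 /\
  forall J q1 q0, feasible B L alpha Vbar J q1 q0 ->
    platform_payoff U B k F Sfix J q0 <= platform_payoff U B k F Sfix I p0.

(* Main.v *)
(** At protection level [I] the cheapest feasible dividend is
    [max (alpha * V) ((alpha - 1) * V)] with [V = Vbar + B I * L], so the platform
    minimizes the maximum of two functions [c * B I + I + const], with
    [c = F + alpha * L * k] and [c = F + (alpha - 1) * L * k]. Each of them is
    minimized where [1 + c * B' I] changes sign, that is at [I4], resp. [I5], or
    at 0 when this slope never vanishes. Their graphs cross where [V = 0], that is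
    at [I2]; between [I5] and [I4] the maximum decreases up to [I2] and increases
    after it. *)

Require Import Defs.
From Stdlib Require Import Reals Lra Psatz.
From Coquelicot Require Import Coquelicot.
Open Scope R_scope.

(** * Calculus with derivatives taken relative to the half line *)

Lemma D_in_interior (f f' : R -> R) (x : R) :
  0 < x -> D_in f f' nonneg_half_line x -> is_derive f x (f' x).
Proof.
  intros Hx HD; apply is_derive_Reals; intros eps Heps.
  destruct (HD eps Heps) as [d [Hd H]].
  (* A radius of at most [x] keeps [x + h] inside the half line. *)
  assert (Hm : 0 < Rmin d x) by (apply Rmin_pos; lra).
  exists (mkposreal _ Hm); simpl; intros h Hh Hlt.
  pose proof (Rmin_l d x); pose proof (Rmin_r d x).
  apply Rabs_def2 in Hlt as Hlt'.
  assert (Hx' : D_x nonneg_half_line x (x + h)).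
  { split; unfold nonneg_half_line; lra. }
  specialize (H (x + h)); simpl in H; unfold Rdist in H.
  replace (x + h - x) with h in H by ring.
  apply H; split; [exact Hx' | lra].
Qed.

(* Truncating at 0 gives a function that is continuous on the whole line, as
   [IVT_gen] and [MVT_gen] require. *)
Lemma D_in_continuity_trunc (f f' : R -> R) :
  (forall x, 0 <= x -> D_in f f' nonneg_half_line x) ->
  continuity (fun x => f (Rmax 0 x)).
Proof.
  intros HD x eps Heps.
  destruct (cont_deriv _ _ _ _ (HD _ (Rmax_l 0 x)) eps Heps) as [d [Hd H]].
  exists d; split; [exact Hd|]; intros y [_ Hy].
  simpl in *; unfold Rdist in *.
  (* The relative limit covers only points distinct from the base point, but truncation may send [y]
     and [x] to the same point. *)
  destruct (Req_dec (Rmax 0 y) (Rmax 0 x)) as [E|E].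
  - rewrite E, Rminus_diag, Rabs_R0; exact Heps.
  - apply H; split.
    + split; [apply Rmax_l | congruence].
    (* Truncation at 0 is 1-Lipschitz. *)
    + apply Rle_lt_trans with (2 := Hy).
      unfold Rmax, Rabs; repeat destruct Rle_dec; repeat destruct Rcase_abs; lra.
Qed.

(** A one-sided derivative at 0 suffices: the derivative is needed only in the open interval, where
    the truncated function locally equals [f]. *)
Lemma D_in_MVT (f f' : R -> R) (a b : R) :
  (forall x, 0 <= x -> D_in f f' nonneg_half_line x) ->
  0 <= a <= b ->
  exists c, a <= c <= b /\ f b - f a = f' c * (b - a).
Proof.
  intros HD Hab.
  destruct (MVT_gen (fun x => f (Rmax 0 x)) a b f') as [c [Hc E]].
  - rewrite Rmin_left, Rmax_right by lra; intros x Hx.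
    apply is_derive_ext_loc with f.
    + assert (Hx0 : 0 < x) by lra.
      exists (mkposreal x Hx0); intros y Hy.
      apply Rabs_def2 in Hy; simpl in Hy.
      unfold minus, plus, opp in Hy; simpl in Hy.
      rewrite Rmax_right by lra; reflexivity.
    + apply D_in_interior; [lra | apply HD; lra].
  - intros x _; exact (D_in_continuity_trunc f f' HD x).
  - rewrite Rmin_left, Rmax_right in Hc by lra.
    rewrite !Rmax_right in E by lra.
    exists c; split; assumption.
Qed.

Lemma D_in_IVT (f f' : R -> R) (a b y : R) :
  (forall x, 0 <= x -> D_in f f' nonneg_half_line x) ->
  0 <= a <= b -> Rmin (f a) (f b) <= y <= Rmax (f a) (f b) ->
  exists x, a <= x <= b /\ f x = y.
Proof.
  intros HD Hab Hy.
  destruct (IVT_gen (fun x => f (Rmax 0 x)) a b y) as [x [Hx E]].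
  - exact (D_in_continuity_trunc f f' HD).
  - rewrite !(Rmax_right 0) by lra; exact Hy.
  - rewrite Rmin_left, Rmax_right in Hx by lra.
    rewrite Rmax_right in E by lra.
    exists x; split; assumption.
Qed.

(** * Monotonicity of [B], of [B'] and of the weighted costs *)

Lemma breach_MVT (B B' B'' : R -> R) (a b : R) :
  breach_probability B B' B'' -> 0 <= a <= b ->
  exists c, a <= c <= b /\ B b - B a = B' c * (b - a).
Proof.
  intros [HD _]; apply D_in_MVT; intros x Hx; apply (HD x Hx).
Qed.

Lemma breach_decreasing (B B' B'' : R -> R) (a b : R) :
  breach_probability B B' B'' -> 0 <= a -> a < b -> B b < B a.
Proof.
  intros HB Ha Hab.
  destruct (breach_MVT B B' B'' a b HB) as [c [Hc E]]; [lra|].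
  destruct HB as [_ [HB _]]; destruct (HB c) as [_ [Hneg _]]; [lra|].
  nra.
Qed.

Lemma breach_derivative_nondecreasing (B B' B'' : R -> R) (a b : R) :
  breach_probability B B' B'' -> 0 <= a <= b -> B' a <= B' b.
Proof.
  intros [HD [HB _]] Hab.
  destruct (D_in_MVT B' B'' a b) as [c [Hc E]]; [|lra|].
  - intros x Hx; apply (HD x Hx).
  - destruct (HB c) as [_ [_ Hpos]]; [lra|].
    nra.
Qed.

(** With the mean value point [z] of [B], the increment of [c * B y + y] from [a] to [b] is exactly
    [(1 + c * B' z) * (b - a)]. *)
Lemma weighted_cost_nondecreasing (B B' B'' : R -> R) (c a b : R) :
  breach_probability B B' B'' -> 0 <= a <= b ->
  (forall x, a <= x <= b -> 0 <= 1 + c * B' x) ->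
  c * B a + a <= c * B b + b.
Proof.
  intros HB Hab H.
  destruct (breach_MVT B B' B'' a b HB Hab) as [z [Hz E]].
  specialize (H z Hz).
  assert (c * (B b - B a) + (b - a) = (1 + c * B' z) * (b - a)) by (rewrite E; ring).
  nra.
Qed.

Lemma weighted_cost_nonincreasing (B B' B'' : R -> R) (c a b : R) :
  breach_probability B B' B'' -> 0 <= a <= b ->
  (forall x, a <= x <= b -> 1 + c * B' x <= 0) ->
  c * B b + b <= c * B a + a.
Proof.
  intros HB Hab H.
  destruct (breach_MVT B B' B'' a b HB Hab) as [z [Hz E]].
  specialize (H z Hz).
  assert (c * (B b - B a) + (b - a) = (1 + c * B' z) * (b - a)) by (rewrite E; ring).
  nra.
Qed.

(** * Sign of the slope [1 + c * B'] and global minimizers of the weighted cost *)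

Lemma marginal_point_slope (B B' B'' : R -> R) (c x : R) :
  breach_probability B B' B'' -> is_marginal_point B' c x ->
  0 < c /\ 0 <= x /\ 1 + c * B' x = 0.
Proof.
  intros [_ [HB _]] [Hc [Hx E]].
  destruct (HB x Hx) as [_ [Hneg _]].
  assert (E' : 1 + c * B' x = 0) by (rewrite E; field; exact Hc).
  repeat split; [nra | exact Hx | exact E'].
Qed.

(** Since [c] is positive and [B'] is nondecreasing, the slope is nondecreasing, and it vanishes at
    [x]. *)
Lemma slope_after_marginal_point (B B' B'' : R -> R) (c x y : R) :
  breach_probability B B' B'' -> is_marginal_point B' c x ->
  x <= y -> 0 <= 1 + c * B' y.
Proof.
  intros HB Hx Hy.
  destruct (marginal_point_slope _ _ _ _ _ HB Hx) as [Hc [Hx0 E]].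
  pose proof (breach_derivative_nondecreasing B B' B'' x y HB (conj Hx0 Hy)).
  nra.
Qed.

Lemma slope_before_marginal_point (B B' B'' : R -> R) (c x y : R) :
  breach_probability B B' B'' -> is_marginal_point B' c x ->
  0 <= y <= x -> 1 + c * B' y <= 0.
Proof.
  intros HB Hx Hy.
  destruct (marginal_point_slope _ _ _ _ _ HB Hx) as [Hc [Hx0 E]].
  pose proof (breach_derivative_nondecreasing B B' B'' y x HB Hy).
  nra.
Qed.

(* A slope of [B] staying below [-1/c] would make [B] nonpositive at [c * B 0]. *)
Lemma slope_without_marginal_point (B B' B'' : R -> R) (c : R) :
  breach_probability B B' B'' -> ~ (exists x, is_marginal_point B' c x) ->
  forall x, 0 <= x -> 0 <= 1 + c * B' x.
Proof.
  intros HB Hno x Hx.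
  pose proof HB as [HD [Hsign _]].
  destruct (Hsign x Hx) as [_ [Hneg _]].
  destruct (Rle_or_lt c 0) as [Hc|Hc]; [nra|].
  destruct (Rle_or_lt 0 (1 + c * B' x)) as [H|H]; [exact H|exfalso].
  assert (Ec : c * (-1 / c) = -1) by (field; lra).
  destruct (Hsign 0) as [HB0 _]; [lra|].
  destruct (breach_MVT B B' B'' 0 (c * B 0) HB) as [z [Hz E]]; [nra|].
  destruct (Hsign (c * B 0)) as [HBz _]; [nra|].
  (* The mean value equation reads [B (c * B 0) = B 0 * (1 + c * B' z)], and both values of [B] are
     positive. *)
  assert (Hsz : 0 < 1 + c * B' z) by nra.
  assert (Hxz : x <= z).
  { destruct (Rle_or_lt x z) as [Hxz|Hxz]; [exact Hxz|].
    pose proof (breach_derivative_nondecreasing B B' B'' z x HB); nra. }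
  (* The slope is negative at [x] and positive at [z], so [B'] takes the value [-1 / c] in
     between. *)
  destruct (D_in_IVT B' B'' x z (-1 / c)) as [w [Hw Ew]].
  - intros t Ht; apply (HD t Ht).
  - lra.
  - assert (B' x <= -1 / c <= B' z) by nra.
    rewrite Rmin_left, Rmax_right by lra; assumption.
  - apply Hno; exists w; split; [lra | split; [lra | exact Ew]].
Qed.

Lemma marginal_point_minimizes (B B' B'' : R -> R) (c x y : R) :
  breach_probability B B' B'' -> is_marginal_point B' c x -> 0 <= y ->
  c * B x + x <= c * B y + y.
Proof.
  intros HB Hx Hy.
  destruct (marginal_point_slope _ _ _ _ _ HB Hx) as [_ [Hx0 _]].
  destruct (Rle_or_lt x y) as [Hxy|Hxy].
  - apply (weighted_cost_nondecreasing B B' B''); [exact HB | lra |].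
    intros z Hz; apply (slope_after_marginal_point B B' B'' c x); trivial; lra.
  - apply (weighted_cost_nonincreasing B B' B''); [exact HB | lra |].
    intros z Hz; apply (slope_before_marginal_point B B' B'' c x); trivial; lra.
Qed.

Lemma zero_minimizes (B B' B'' : R -> R) (c y : R) :
  breach_probability B B' B'' -> ~ (exists x, is_marginal_point B' c x) -> 0 <= y ->
  c * B 0 + 0 <= c * B y + y.
Proof.
  intros HB Hno Hy.
  apply (weighted_cost_nondecreasing B B' B''); [exact HB | lra |].
  intros z Hz; apply (slope_without_marginal_point B B' B''); trivial; lra.
Qed.

(** * Sufficient conditions for optimality, by the sign of the user cost *)

(* The multiplier [a] may depend on the competing level [J]: this is what makes
   the kink [V = 0] optimal. *)
Lemma optimal_of_minimal (U : nat -> nat -> R) (B : R -> R) (k : nat)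
    (F L Sfix alpha Vbar x p0 : R) :
  0 <= x -> 0 <= p0 ->
  alpha * (Vbar + B x * L) <= p0 -> (alpha - 1) * (Vbar + B x * L) <= p0 ->
  (forall J, 0 <= J -> exists a, (a = alpha \/ a = alpha - 1) /\
     p0 = a * (Vbar + B x * L) /\
     (F + a * L * INR k) * B x + x <= (F + a * L * INR k) * B J + J) ->
  optimal U B k F L Sfix alpha Vbar x 0 p0.
Proof.
  intros Hx Hp0 Hhigh Hlow Hmin.
  unfold optimal, feasible, utility_low, utility_high, user_cost, platform_payoff.
  split; [repeat split; lra|].
  intros J q1 q0 [Hsel [Hir [HJ [Hq0 Hq1]]]].
  destruct (Hmin J) as [a [Ha [Ep0 Hcost]]]; [lra|].
  (* Nonnegative utility gives the bound for [alpha]; the choice constraint with [q1 >= 0] gives it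
     for [alpha - 1]. *)
  assert (Hq : a * (Vbar + B J * L) <= q0) by (destruct Ha; subst a; lra).
  pose proof (Rmult_le_compat_r (INR k) _ _ (pos_INR k) Hq).
  rewrite Ep0; lra.
Qed.

Lemma optimal_nonneg_cost (U : nat -> nat -> R) (B : R -> R) (k : nat)
    (F L Sfix alpha Vbar x : R) :
  0 < alpha < 1 -> 0 <= x -> 0 <= Vbar + B x * L ->
  (forall J, 0 <= J ->
     (F + alpha * L * INR k) * B x + x <= (F + alpha * L * INR k) * B J + J) ->
  optimal U B k F L Sfix alpha Vbar x 0 (alpha * (Vbar + B x * L)).
Proof.
  intros Ha Hx HV Hmin; apply optimal_of_minimal; [exact Hx | nra | nra | nra |].
  intros J HJ; exists alpha; auto.
Qed.

Lemma optimal_nonpos_cost (U : nat -> nat -> R) (B : R -> R) (k : nat)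
    (F L Sfix alpha Vbar x : R) :
  0 < alpha < 1 -> 0 <= x -> Vbar + B x * L <= 0 ->
  (forall J, 0 <= J ->
     (F + (alpha - 1) * L * INR k) * B x + x
     <= (F + (alpha - 1) * L * INR k) * B J + J) ->
  optimal U B k F L Sfix alpha Vbar x 0 ((alpha - 1) * (Vbar + B x * L)).
Proof.
  intros Ha Hx HV Hmin; apply optimal_of_minimal; [exact Hx | nra | nra | nra |].
  intros J HJ; exists (alpha - 1); auto.
Qed.

(** Only slope signs are assumed at [x4] and [x5], so that [x5 = 0] can replace a missing [I5]. *)
Lemma optimal_zero_cost (U : nat -> nat -> R) (B B' B'' : R -> R) (k : nat)
    (F L Sfix alpha Vbar x4 x5 : R) :
  breach_probability B B' B'' -> 0 < L -> 0 <= x5 <= x4 ->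
  Vbar + B x4 * L <= 0 <= Vbar + B x5 * L ->
  (forall y, 0 <= y <= x4 -> 1 + (F + alpha * L * INR k) * B' y <= 0) ->
  (forall y, x5 <= y -> 0 <= 1 + (F + (alpha - 1) * L * INR k) * B' y) ->
  exists I2 : R, unique (is_I2 B L Vbar) I2 /\
    optimal U B k F L Sfix alpha Vbar I2 0 0.
Proof.
  intros HB HL Hx HV Hs4 Hs5.
  assert (EL : - Vbar / L * L = - Vbar) by (field; lra).
  destruct (D_in_IVT B B' x5 x4 (- Vbar / L)) as [x [Hx' E]].
  - intros t Ht; apply (proj1 HB t Ht).
  - exact Hx.
  - assert (B x4 <= - Vbar / L <= B x5) by nra.
    rewrite Rmin_right, Rmax_left by lra; assumption.
  - assert (EV : Vbar + B x * L = 0) by (rewrite E; lra).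
    exists x; split.
    + split; [split; [lra | exact E]|].
      intros y [Hy Ey].
      destruct (Rtotal_order x y) as [H|[H|H]]; [|exact H|].
      * pose proof (breach_decreasing B B' B'' x y HB); lra.
      * pose proof (breach_decreasing B B' B'' y x HB); lra.
    + apply optimal_of_minimal; rewrite ?EV; try lra.
      (* At zero cost both multipliers give dividend 0, so the one whose weighted cost is monotone
         on the side of [J] may be used. *)
      intros J HJ; destruct (Rle_or_lt J x) as [H|H].
      * exists alpha; repeat split; [auto | lra |].
        apply (weighted_cost_nonincreasing B B' B''); [exact HB | lra |].
        intros z Hz; apply Hs4; lra.
      * exists (alpha - 1); repeat split; [auto | lra |].
        apply (weighted_cost_nondecreasing B B' B''); [exact HB | lra |].
        intros z Hz; apply Hs5; lra.
Qed.

(** * From thresholds on [L] to signs of the user cost, and the case analysis *)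

Lemma cost_nonneg_of_loss_ge (b L Vbar : R) :
  0 < b -> L >= - Vbar / b -> 0 <= Vbar + b * L.
Proof.
  intros Hb H; assert (E : - Vbar / b * b = - Vbar) by (field; lra); nra.
Qed.

Lemma cost_nonpos_of_loss_le (b L Vbar : R) :
  0 < b -> - Vbar / b >= L -> Vbar + b * L <= 0.
Proof.
  intros Hb H; assert (E : - Vbar / b * b = - Vbar) by (field; lra); nra.
Qed.

Theorem mainTheorem7
    (k : nat) (U : nat -> nat -> R) (B B' B'' : R -> R)
    (F L Sfix alpha Vbar : R)
    (hk : (1 <= k)%nat)
    (hB : breach_probability B B' B'')
    (hF : 0 < F) (hL : 0 < L)
    (halpha : 0 < alpha < 1)
    (hVbar : Vbar <= 0) :
  (forall I4 I5 : R,
     is_I4 B' k F L alpha I4 -> is_I5 B' k F L alpha I5 ->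
     (L >= - Vbar / B I4 ->
        optimal U B k F L Sfix alpha Vbar I4 0 (alpha * (Vbar + B I4 * L))) /\
     (- Vbar / B I4 >= L /\ L >= - Vbar / B I5 ->
        exists I2 : R, unique (is_I2 B L Vbar) I2 /\
          optimal U B k F L Sfix alpha Vbar I2 0 0) /\
     (- Vbar / B I5 >= L ->
        optimal U B k F L Sfix alpha Vbar
          I5 0 ((alpha - 1) * (Vbar + B I5 * L))))
  /\
  (forall I4 : R,
     is_I4 B' k F L alpha I4 -> ~ (exists I5 : R, is_I5 B' k F L alpha I5) ->
     (L >= - Vbar / B I4 ->
        optimal U B k F L Sfix alpha Vbar I4 0 (alpha * (Vbar + B I4 * L))) /\
     (- Vbar / B I4 >= L /\ L >= - Vbar / B 0 ->
        exists I2 : R, unique (is_I2 B L Vbar) I2 /\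
          optimal U B k F L Sfix alpha Vbar I2 0 0) /\
     (- Vbar / B 0 >= L ->
        optimal U B k F L Sfix alpha Vbar
          0 0 ((alpha - 1) * (Vbar + B 0 * L))))
  /\
  (~ (exists I4 : R, is_I4 B' k F L alpha I4) ->
   ~ (exists I5 : R, is_I5 B' k F L alpha I5) ->
     (L >= - Vbar / B 0 ->
        optimal U B k F L Sfix alpha Vbar 0 0 (alpha * (Vbar + B 0 * L))) /\
     (- Vbar / B 0 >= L ->
        optimal U B k F L Sfix alpha Vbar
          0 0 ((alpha - 1) * (Vbar + B 0 * L)))).
Proof.
  pose proof hB as [_ [Hsign _]].
  assert (Hpos : forall x, 0 <= x -> 0 < B x) by (intros x Hx; apply (Hsign x Hx)).
  assert (HB0 : 0 < B 0) by (apply Hpos; lra).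
  split; [|split].
  - intros I4 I5 H4 H5.
    destruct (marginal_point_slope _ _ _ _ _ hB H4) as [_ [HI4 E4]].
    destruct (marginal_point_slope _ _ _ _ _ hB H5) as [_ [HI5 _]].
    split; [|split].
    + intros H; apply optimal_nonneg_cost; auto using cost_nonneg_of_loss_ge.
      intros J HJ; apply (marginal_point_minimizes B B' B''); assumption.
    + intros [Hhi Hlo].
      apply (optimal_zero_cost U B B' B'' k F L Sfix alpha Vbar I4 I5); trivial.
      * split; [exact HI5|].
        (* If [I4 < I5], the slope at [I4] with the weight of [I5] is at most 0. The weight of [I4]
           is larger by [L * INR k > 0] and [B' I4 < 0], so its slope there would be negative, not
           0. *)
        destruct (Rle_or_lt I5 I4) as [H|H]; [exact H|exfalso].
        pose proof (slope_before_marginal_point B B' B'' _ I5 I4 hB H5) as Hs.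
        destruct (Hsign I4 HI4) as [_ [Hneg _]].
        assert (HkL : 0 < L * INR k)
          by (apply Rmult_lt_0_compat; [exact hL | apply lt_0_INR; lia]).
        nra.
      * auto using cost_nonneg_of_loss_ge, cost_nonpos_of_loss_le.
      * intros y Hy; apply (slope_before_marginal_point B B' B'' _ I4); assumption.
      * intros y Hy; apply (slope_after_marginal_point B B' B'' _ I5); assumption.
    + intros H; apply optimal_nonpos_cost; auto using cost_nonpos_of_loss_le.
      intros J HJ; apply (marginal_point_minimizes B B' B''); assumption.
  - intros I4 H4 H5.
    destruct (marginal_point_slope _ _ _ _ _ hB H4) as [_ [HI4 _]].
    split; [|split].
    + intros H; apply optimal_nonneg_cost; auto using cost_nonneg_of_loss_ge.
      intros J HJ; apply (marginal_point_minimizes B B' B''); assumption.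
    + intros [Hhi Hlo].
      (* Without [I5] the slope for [alpha - 1] is nonnegative on the whole half line, so 0 takes
         its place. *)
      apply (optimal_zero_cost U B B' B'' k F L Sfix alpha Vbar I4 0); trivial.
      * lra.
      * auto using cost_nonneg_of_loss_ge, cost_nonpos_of_loss_le.
      * intros y Hy; apply (slope_before_marginal_point B B' B'' _ I4); assumption.
      * intros y Hy; apply (slope_without_marginal_point B B' B''); assumption.
    + intros H; apply optimal_nonpos_cost;
        auto using cost_nonpos_of_loss_le, Rle_refl.
      intros J HJ; apply (zero_minimizes B B' B''); assumption.
  - intros H4 H5; split; intros H.
    + apply optimal_nonneg_cost; auto using cost_nonneg_of_loss_ge, Rle_refl.
      intros J HJ; apply (zero_minimizes B B' B''); assumption.
    + apply optimal_nonpos_cost; auto using cost_nonpos_of_loss_le, Rle_refl.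
      intros J HJ; apply (zero_minimizes B B' B''); assumption.
Qed.
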